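(* Let $\tau>0$, $a\in\mathbb{R}$ and $\eta\in\mathbb{C}$. Then every solution $s\in\mathbb{C}$ of the equation $$s-a-\eta e^{-s\tau}=0$$ belongs to $\mathbb{C}\setminus\mathbb{C}_+$ if and only if $a\leq\frac{1}{\tau}$ and $\eta$ belongs to the closure (in $\mathbb{C}$) of the set $\Lambda_{\tau,a}$.
   Context: Notation: $\mathbb{C}_+=\{s\in\mathbb{C}:\operatorname{Re}(s)>0\}$; $\mathbb{D}_r\subset\mathbb{C}$ is the open disc centred at $0$ with radius $r>0$; $\operatorname{Arg}$ is the principal argument, with values in $(-\pi,\pi]$; $\arctan$ is the real arctangent with values in $(-\frac{\pi}{2},\frac{\pi}{2})$. For $\tau>0$ and $a\in(-\infty,\frac1\tau]$ the set $\Lambda_{\tau,a}\subset\mathbb{C}$ is defined as follows. (1) For $a<0$: $$\Lambda_{\tau,a}:=\Big\{\eta\in\mathbb{C}\setminus\mathbb{D}_{|a|}:\ \operatorname{Re}\eta+a<0,\ |\eta|<|\eta_\pi|,\ |\operatorname{Arg}\eta|>\tau\sqrt{|\eta|^2-a^2}+\arctan\Big(-\frac1a\sqrt{|\eta|^2-a^2}\Big)\Big\}\cup\mathbb{D}_{|a|},$$ where $\eta_\pi$ is such that $\tau\sqrt{|\eta_\pi|^2-a^2}+\arctan\big(-\frac1a\sqrt{|\eta_\pi|^2-a^2}\big)=\pi$. (2) For $a=0$: $$\Lambda_{\tau,0}:=\Big\{\eta\in\mathbb{C}\setminus\{0\}:\ \operatorname{Re}\eta<0,\ |\eta|<\frac{\pi}{2\tau},\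 |\operatorname{Arg}\eta|>\tau|\eta|+\frac{\pi}{2}\Big\}.$$ (3) For $0<a\leq\frac1\tau$: $$\Lambda_{\tau,a}:=\Big\{\eta\in\mathbb{C}:\ \operatorname{Re}\eta+a<0,\ |\eta|<|\eta_\pi|,\ |\operatorname{Arg}\eta|>\tau\sqrt{|\eta|^2-a^2}+\arctan\Big(-\frac1a\sqrt{|\eta|^2-a^2}\Big)+\pi\Big\},$$ where $\eta_\pi$ is such that $|\eta_\pi|>a$ and $\tau\sqrt{|\eta_\pi|^2-a^2}+\arctan\big(-\frac1a\sqrt{|\eta_\pi|^2-a^2}\big)=0$.
   Formalization: At a = 1/τ no η_π with |η_π| > a exists, so Λ_{τ,1/τ} is undefined (or empty, making the claim false at η = −1/τ); the formal statement sets Λ_{τ,1/τ} = {−1/τ}, and every other case is as stated. *)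

(* Defs.v *)
From Stdlib Require Import Reals Lra.
From Coquelicot Require Import Coquelicot.

Open Scope R_scope.

Definition Cexp (z : C) : C := (exp (Re z) * cos (Im z), exp (Re z) * sin (Im z)).

(* Principal argument, with values in (-PI, PI] by [Carg_spec]. [Carg 0] is a
   junk value, never used in [Lambda]. *)
Definition Carg (z : C) : R :=
  if Rle_dec 0 (Im z) then acos (Re z / Cmod z) else - acos (Re z / Cmod z).

Lemma Carg_spec (z : C) : z <> RtoC 0 ->
  - PI < Carg z <= PI /\ z = (Cmod z * cos (Carg z), Cmod z * sin (Carg z)).
Proof.
intros Hz.
assert (Hm : 0 < Cmod z) by now apply Cmod_gt_0.
destruct z as [x y].
assert (Hsq : Cmod (x, y) * Cmod (x, y) = x * x + y * y).
{ unfold Cmod; cbn [fst snd]. rewrite sqrt_sqrt; [ring | nra]. }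
unfold Carg; cbn [Re Im fst snd].
set (m := Cmod (x, y)) in *.
set (t := x / m).
assert (Hx : x = m * t) by (unfold t; field; lra).
assert (Ht : -1 <= t <= 1) by
  (assert (t * t <= 1) by (apply Rmult_le_reg_l with (m * m); nra); split; nra).
assert (Hy : Rabs y = m * sqrt (1 - t²)).
{ rewrite <- sqrt_Rsqr_abs, <- (sqrt_square m), <- sqrt_mult by (unfold Rsqr; nra).
  f_equal. unfold Rsqr. rewrite Hx in Hsq. lra. }
pose proof (acos_bound t). pose proof PI_RGT_0.
destruct (Rle_dec 0 y) as [Hi | Hi].
- split; [lra |].
  rewrite cos_acos, sin_acos, <- Hx, <- Hy, Rabs_pos_eq by lra; reflexivity.
- assert (acos t <> PI).
  { intros E. rewrite <- sin_acos, E, sin_PI, Rmult_0_r in Hy by lra.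
    rewrite Rabs_left in Hy; lra. }
  split; [lra |].
  rewrite cos_neg, sin_neg, cos_acos, sin_acos, <- Hx by lra.
  rewrite Rabs_left in Hy by lra. f_equal; lra.
Qed.

Definition Cclosure (A : C -> Prop) (z : C) : Prop :=
  forall eps : R, 0 < eps -> exists w : C, A w /\ Cmod (w - z) < eps.

(* The real square root only makes sense for |a| <= |eta|; Rocq's [sqrt]
   returns 0 on negative arguments. *)
Definition Lambda_phase (tau a : R) (eta : C) : R :=
  tau * sqrt (Cmod eta ^ 2 - a ^ 2)
  + atan (- (1 / a) * sqrt (Cmod eta ^ 2 - a ^ 2)).

(* Only |eta_pi| is determined by (and used in) the two definitions below. *)
Definition Lambda_neg (tau a : R) (eta : C) : Prop :=
  (~ Cmod eta < Rabs a /\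
   exists eta_pi : C,
     Rabs a <= Cmod eta_pi /\ Lambda_phase tau a eta_pi = PI /\
     Re eta + a < 0 /\ Cmod eta < Cmod eta_pi /\
     Rabs (Carg eta) > Lambda_phase tau a eta)
  \/ Cmod eta < Rabs a.

Definition Lambda_zero (tau : R) (eta : C) : Prop :=
  eta <> RtoC 0 /\ Re eta < 0 /\ Cmod eta < PI / (2 * tau) /\
  Rabs (Carg eta) > tau * Cmod eta + PI / 2.

Definition Lambda_pos (tau a : R) (eta : C) : Prop :=
  exists eta_pi : C,
    a < Cmod eta_pi /\ Lambda_phase tau a eta_pi = 0 /\
    Re eta + a < 0 /\ Cmod eta < Cmod eta_pi /\
    Rabs (Carg eta) > Lambda_phase tau a eta + PI.

(* At a = 1/tau no eta_pi exists (tau w = atan (tau w) forces w = 0), and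
   [Lambda_pos] is empty with or without the bound by |eta_pi|. As a increases
   to 1/tau the sets shrink to the point -1/tau, for which all roots of
   s - 1/tau + exp (- s tau) / tau do lie in Re s <= 0; the last disjunct takes
   this point as the value of Lambda in the degenerate case. *)
Definition Lambda (tau a : R) (eta : C) : Prop :=
  (a < 0 /\ Lambda_neg tau a eta) \/
  (a = 0 /\ Lambda_zero tau eta) \/
  (0 < a <= 1 / tau /\ Lambda_pos tau a eta) \/
  (a = 1 / tau /\ eta = RtoC (- a)).

(* Main.v *)
Require Import Defs.
From Stdlib Require Import Reals Lra Psatz.
From Coquelicot Require Import Coquelicot.
Open Scope R_scope.

(** Write the equation as [(s - a) e^(tau s) = eta]. A root on the line
    [Re s = x] has [|s - a| = r e^(- tau x)] with [r = |eta|], so up to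
    conjugation it is determined by [x], and the argument of [eta] must then
    equal the phase [tau Im s + arg (s - a)], taken with [Im s >= 0]. Regard
    this phase as a function of [x] ([shifted_phase]); at [x = 0] it is the
    function [crossing_phase] of [r], which describes the boundary of
    [Lambda].

    If [a <= 1 / tau] and [|a| <= r] with [r > 0], the abscissas [x >= 0] admitting a
    point of the right modulus form an interval starting at 0, on which the
    phase decreases strictly to 0, because the derivative of
    [tau s + log (s - a)] is [tau + 1 / (s - a)]
    ([shifted_phase_derive_neg], [shifted_phase_lt]). By the intermediate value
    theorem ([right_root_abscissa_exists]) a root with positive real part exists
    precisely when the absolute value of the argument of [eta] is less than
    the crossing phase of [r]. For [eta = 0] the only root is [a]. When
    [0 < r < |a|], the modulus excludes such a root for [a < 0], and for
    [a > 0] a translation of [s] to the abscissa where the root curve begins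
    produces one. A translation also reduces [a > 1 / tau] to [a = 1 / tau], where
    the crossing phase is at least [PI]. This gives the criterion
    [no_right_root_iff], without any counting of zeros.

    It remains to see that the closure of [Lambda] is described by the same
    weak inequality of phases. One inclusion is continuity off the origin
    ([closure_Lambda_bounds]). For the other, a point with the weak inequality
    is the end of a path with the strict one: a radial path if [a <= 0], where
    the crossing phase increases with the modulus ([closure_Lambda_nonpos]);
    and if [0 < a < 1 / tau] a path that also turns the argument towards
    [PI], since the crossing phase then first decreases and later increases
    ([closure_Lambda_pos]). The half plane condition and the bound by
    [|eta_pi|] in [Lambda] follow from the strict inequality. *)

(** * Calculus of arc cosine and arc tangent *)

(** The points -1 and 1, where [acos] is not differentiable, matter: the
    argument reaches them at the ends of the root curve. For [t > 0] the formula
    [acos t = atan (sqrt (1 - t^2) / t)] also covers [t >= 1], and the symmetry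
    [acos (- t) = PI - acos t] gives the other half line. *)
Lemma continuous_acos (x : R) : continuous acos x.
Proof.
assert (Hpos : forall t, 0 < t -> continuous acos t).
{ intros t Ht.
  apply continuous_ext_loc with (fun u => atan (sqrt (1 - u * u) / u)).
  - exists (mkposreal t Ht). intros u Hu.
    unfold ball in Hu; simpl in Hu; unfold AbsRing_ball, abs, minus, plus, opp in Hu; simpl in Hu.
    apply Rabs_def2 in Hu. symmetry. apply acos_atan. lra.
  - apply continuous_atan_comp.
    apply (continuous_mult (fun u => sqrt (1 - u * u)) Rinv).
    + apply continuous_sqrt_comp.
      apply (continuous_minus (fun _ => 1) (fun u => u * u)).
      * apply continuous_const.
      * apply (continuous_mult (fun u : R => u) (fun u : R => u)); apply continuous_id.
    + apply continuous_Rinv. lra. }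
destruct (Rtotal_order x 0) as [Hx | [-> | Hx]].
- apply continuous_ext with (fun u => PI - acos (- u)).
  + intros u. rewrite acos_opp. apply Rminus_diag_uniq. ring.
  + apply (continuous_minus (fun _ => PI) (fun u => acos (- u))).
    * apply continuous_const.
    * apply (continuous_comp Ropp acos).
      -- apply (continuous_opp (fun u : R => u)), continuous_id.
      -- apply Hpos. lra.
- apply continuity_pt_filterlim, derivable_continuous_pt, derivable_pt_acos. lra.
- now apply Hpos.
Qed.

Lemma is_derive_acos (t : R) :
  -1 < t < 1 -> is_derive acos t (- / sqrt (1 - t ^ 2)).
Proof.
intros Ht. apply is_derive_Reals.
replace (- / sqrt (1 - t ^ 2)) with (-1 / sqrt (1 - Rsqr t)).
- rewrite <- (derive_pt_acos t Ht). apply (derive_pt_eq_1 _ _ _ (derivable_pt_acos t Ht)). reflexivity.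
- replace (t ^ 2) with (Rsqr t) by (unfold Rsqr; ring). unfold Rdiv. ring.
Qed.

Lemma Rdiv_abs_le_1 (p r : R) : 0 < r -> Rabs p <= r -> -1 <= p / r <= 1.
Proof.
intros Hr Hp. apply Rabs_le_between in Hp.
split; [apply Rle_div_r | apply Rle_div_l]; lra.
Qed.

Lemma decreasing_of_derive_neg (f : R -> R) (u v : R) :
  u < v -> (forall t, u <= t <= v -> continuous f t) ->
  (forall t, u < t < v -> exists d, d < 0 /\ is_derive f t d) ->
  f v < f u.
Proof.
intros Huv Hcont Hder.
assert (pr : forall c, u < c < v -> derivable_pt f c).
{ intros c Hc. exists (Derive f c). apply is_derive_Reals, Derive_correct.
  destruct (Hder c Hc) as (d & _ & Hd). now exists d. }
destruct (MVT f id u v pr (fun c _ => derivable_pt_id c)) as (c & Hc & E); trivial.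
- intros c Hc. now apply continuity_pt_filterlim, Hcont.
- intros. apply derivable_continuous_pt, derivable_pt_id.
- destruct (Hder c Hc) as (d & Hd0 & Hd).
  rewrite derive_pt_id, (derive_pt_eq_0 _ _ d) in E by now apply is_derive_Reals.
  unfold id in E. nra.
Qed.

Lemma atan_lt_id (t : R) : 0 < t -> atan t < t.
Proof.
intros Ht. enough (atan t - t < atan 0 - 0) by (rewrite atan_0 in *; lra).
assert (D : forall u, is_derive (fun u => atan u - u) u (/ (1 + u ^ 2) - 1)).
{ intros u. apply (is_derive_minus atan (fun u => u)).
  - apply is_derive_Reals, derivable_pt_lim_atan.
  - apply (is_derive_id (K := R_AbsRing)). }
apply (decreasing_of_derive_neg (fun u => atan u - u)); trivial.
- intros u _. apply (ex_derive_continuous (fun u => atan u - u)). eexists. apply D.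
- intros u Hu. exists (/ (1 + u ^ 2) - 1). split; [| apply D].
  enough (/ (1 + u ^ 2) < / 1) by (rewrite Rinv_1 in *; lra).
  apply Rinv_lt_contravar; nra.
Qed.

Lemma inv_tau_pos (tau : R) : 0 < tau -> 0 < 1 / tau.
Proof. intros. apply Rdiv_lt_0_compat; lra. Qed.

(** * The crossing phase along vertical lines *)

(** If [i w] is a root then [|eta|^2 = a^2 + w^2] and, up to sign, the argument
    of [eta] is that of [i |w| - a] plus [tau |w|]; with [r = |eta|] this is the
    number below. The arc cosine treats all signs of [a] at once. *)
Definition crossing_phase (tau a r : R) : R :=
  tau * sqrt (r ^ 2 - a ^ 2) + acos (- a / r).

(** The absolute value of the principal argument, in a form whose continuity
    off the origin is plain. *)
Definition unsigned_arg (z : C) : R := acos (Re z / Cmod z).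

Lemma continuous_crossing_phase (U : UniformSpace) (tau : R) (a r : U -> R) (u : U) :
  r u <> 0 -> continuous a u -> continuous r u ->
  continuous (fun v => crossing_phase tau (a v) (r v)) u.
Proof.
intros Hr Ca Cr. unfold crossing_phase.
assert (Csq : forall f : U -> R, continuous f u -> continuous (fun v => f v ^ 2) u).
{ intros f Cf. apply continuous_ext with (fun v => f v * f v).
  - intros v. simpl. apply Rminus_diag_uniq. ring.
  - now apply (continuous_mult f f). }
apply (continuous_plus (fun v => tau * sqrt (r v ^ 2 - a v ^ 2)) (fun v => acos (- a v / r v))).
- apply (continuous_mult (fun _ => tau) (fun v => sqrt (r v ^ 2 - a v ^ 2))).
  + apply continuous_const.
  + apply (continuous_comp (fun v => r v ^ 2 - a v ^ 2) sqrt); [| apply continuous_sqrt].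
    apply (continuous_minus (fun v => r v ^ 2) (fun v => a v ^ 2)); now apply Csq.
- apply (continuous_comp (fun v => - a v / r v) acos).
  + apply (continuous_mult (fun v => - a v) (fun v => / r v)).
    * now apply (continuous_opp a).
    * apply (continuous_comp r Rinv); [assumption |]. now apply continuous_Rinv.
  + apply continuous_acos.
Qed.

(** Substituting [s + x] for [s] changes [(a, eta)] into
    [(a - x, eta e^(- tau x))]; so this is the phase that [eta] must have for a
    root with real part [x]. *)
Definition shifted_phase (tau a r x : R) : R :=
  crossing_phase tau (a - x) (r * exp (- tau * x)).

Lemma continuous_shifted_phase (tau a r x : R) :
  0 < r -> continuous (shifted_phase tau a r) x.
Proof.
intros Hr.
apply (continuous_crossing_phase R_UniformSpace tau (fun v => a - v)
  (fun v => r * exp (- tau * v))).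
- pose proof (exp_pos (- tau * x)). nra.
- apply (ex_derive_continuous (fun v => a - v)). auto_derive; trivial.
- apply (ex_derive_continuous (fun v => r * exp (- tau * v))). auto_derive; trivial.
Qed.

(** With [p = x - a] and [q] the height of the point of modulus
    [r e^(- tau x)] above [p], the logarithm of [(s - a) e^(tau s)] has
    derivative [tau + 1 / (s - a)], and along a curve of constant modulus this
    gives the phase the derivative [- |1 + tau (p + i q)|^2 / q]. *)
Lemma shifted_phase_derive_neg (tau a r x : R) :
  0 < tau -> 0 < r -> Rabs (x - a) < r * exp (- tau * x) ->
  exists d, d < 0 /\ is_derive (shifted_phase tau a r) x d.
Proof.
intros Ht Hr Hx. apply Rabs_def2 in Hx.
assert (Hm : 0 < r * exp (- tau * x)) by (pose proof (exp_pos (- tau * x)); nra).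
set (m := r * exp (- tau * x)) in *.
set (p := x - a) in *.
assert (Hh : 0 < m ^ 2 - p ^ 2) by nra.
set (q := sqrt (m ^ 2 - p ^ 2)).
assert (Hq : 0 < q) by now apply sqrt_lt_R0.
assert (Hqq : q * q = m ^ 2 - p ^ 2) by (apply sqrt_sqrt; lra).
exists (- ((1 + tau * p) ^ 2 + tau ^ 2 * q ^ 2) / q). split.
{ unfold Rdiv. apply Rmult_lt_reg_r with q; [lra |].
  rewrite Rmult_assoc, Rinv_l by lra.
  assert (0 < tau ^ 2 * q ^ 2) by (apply Rmult_lt_0_compat; nra).
  pose proof (pow2_ge_0 (1 + tau * p)). lra. }
unfold shifted_phase, crossing_phase.
assert (Dm : is_derive (fun v => r * exp (- tau * v)) x (- tau * m)).
{ unfold m. auto_derive; trivial. ring. }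
assert (D1 : is_derive (fun v => tau * sqrt ((r * exp (- tau * v)) ^ 2 - (a - v) ^ 2)) x
   (tau * ((- 2 * tau * m ^ 2 - 2 * p) / (2 * q)))).
{ apply is_derive_scal.
  replace q with (sqrt ((r * exp (- tau * x)) ^ 2 - (a - x) ^ 2)).
  - apply (is_derive_sqrt (fun v => (r * exp (- tau * v)) ^ 2 - (a - v) ^ 2)).
    + unfold m, p. auto_derive; trivial. ring.
    + fold m. replace (a - x) with (- p) by (unfold p; ring). nra.
  - unfold q. f_equal. fold m. unfold p. ring. }
assert (D2 : is_derive (fun v => acos (- (a - v) / (r * exp (- tau * v)))) x
   ((1 + tau * p) / m * (- / sqrt (1 - (p / m) ^ 2)))).
{ apply (is_derive_comp acos (fun v => - (a - v) / (r * exp (- tau * v)))).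
  - replace (- (a - x) / (r * exp (- tau * x))) with (p / m)
      by (unfold p, m; f_equal; ring).
    apply is_derive_acos. split.
    + apply Rlt_div_r; lra.
    + apply Rlt_div_l; lra.
  - replace ((1 + tau * p) / m) with ((1 * m - p * (- tau * m)) / m ^ 2) by (field; lra).
    apply is_derive_ext with (fun v => (v - a) / (r * exp (- tau * v))).
    { intros v. f_equal. ring. }
    apply (is_derive_div (fun v => v - a) (fun v => r * exp (- tau * v))).
    + auto_derive; trivial.
    + exact Dm.
    + fold m. lra. }
assert (Hs : sqrt (1 - (p / m) ^ 2) = q / m).
{ replace (1 - (p / m) ^ 2) with ((q / m) * (q / m)).
  - apply sqrt_square. apply Rlt_le, Rdiv_lt_0_compat; lra.
  - replace (q / m * (q / m)) with (q * q / m ^ 2) by (field; lra). rewrite Hqq. field. lra. }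
rewrite Hs in D2.
assert (E : - ((1 + tau * p) ^ 2 + tau ^ 2 * q ^ 2) / q =
  tau * ((- 2 * tau * m ^ 2 - 2 * p) / (2 * q)) + (1 + tau * p) / m * (- / (q / m))).
{ replace (m ^ 2) with (q * q + p ^ 2) by lra. field. lra. }
rewrite E.
apply (is_derive_plus (fun v => tau * sqrt ((r * exp (- tau * v)) ^ 2 - (a - v) ^ 2)) _ _ _ _ D1 D2).
Qed.

Lemma shifted_phase_0 (tau a r : R) :
  shifted_phase tau a r 0 = crossing_phase tau a r.
Proof.
unfold shifted_phase. rewrite Rmult_0_r, exp_0. f_equal; ring.
Qed.

(** The bound on [a] enters the monotonicity through this inequality: by
    convexity [e^(- tau t) > 1 - tau t], and [a tau <= 1]. *)
Lemma gap_upper_bound (tau a t : R) :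
  0 < tau -> a <= 1 / tau -> 0 < t < a -> a - t < a * exp (- tau * t).
Proof.
intros Htau Ha Ht.
assert (1 + - tau * t < exp (- tau * t)) by (apply exp_ineq1; nra).
assert (tau * a <= 1).
{ apply Rmult_le_compat_l with (r := tau) in Ha; [| lra].
  replace (tau * (1 / tau)) with 1 in Ha by (field; lra). exact Ha. }
nra.
Qed.

Lemma exp_decay_le (tau x t : R) : 0 < tau -> t <= x -> exp (- tau * x) <= exp (- tau * t).
Proof.
intros Htau [Htx | ->]; [| lra]. apply Rlt_le, exp_increasing. nra.
Qed.

(** A root with real part [t] needs [|t - a| <= r e^(- tau t)]. Connectedness
    of the set of such [t >= 0] is what lets the derivative be integrated from
    the imaginary axis to [x]. *)
Lemma shifted_domain_interval (tau a r x t : R) :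
  0 < tau -> a <= 1 / tau -> 0 < r -> Rabs a <= r ->
  Rabs (x - a) <= r * exp (- tau * x) -> 0 < t < x ->
  Rabs (t - a) < r * exp (- tau * t).
Proof.
intros Htau Ha Hr Har Hx Ht.
apply Rabs_le_between in Har. apply Rabs_le_between in Hx.
pose proof (exp_pos (- tau * t)) as He.
apply Rabs_def1.
- pose proof (exp_decay_le tau x t Htau). nra.
- destruct (Rle_dec a t) as [Hat | Hat]; [nra |].
  pose proof (gap_upper_bound tau a t Htau Ha). nra.
Qed.

(** This yields stability: a root to the right of the axis forces [eta] to
    have phase smaller than the crossing phase. *)
Lemma shifted_phase_lt (tau a r x : R) :
  0 < tau -> a <= 1 / tau -> 0 < r -> Rabs a <= r ->
  0 < x -> Rabs (x - a) <= r * exp (- tau * x) ->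
  shifted_phase tau a r x < crossing_phase tau a r.
Proof.
intros Htau Ha Hr Har Hx Hd.
rewrite <- shifted_phase_0.
apply decreasing_of_derive_neg; trivial.
- intros t _. now apply continuous_shifted_phase.
- intros t Ht. apply shifted_phase_derive_neg; trivial.
  now apply (shifted_domain_interval tau a r x).
Qed.

(** For [psi] in [[0, PI]]: some root for the gain of modulus [r] and unsigned
    argument [psi] has real part [x]; see [root_on_vertical] and
    [root_of_abscissa]. *)
Definition right_root_abscissa (tau a r psi x : R) : Prop :=
  Rabs (x - a) <= r * exp (- tau * x) /\ shifted_phase tau a r x = psi.

(** The phase moves continuously from the crossing phase at [x = 0] to 0 at
    the abscissa [x1 > a] where the height vanishes, so it takes the value
    [psi] in between. *)
Lemma right_root_abscissa_exists (tau a r psi : R) :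
  0 < tau -> a <= 1 / tau -> 0 < r -> Rabs a <= r ->
  0 <= psi <= crossing_phase tau a r ->
  exists x, 0 <= x /\ right_root_abscissa tau a r psi x.
Proof.
intros Htau Ha Hr Har Hpsi.
assert (Har' := Har). apply Rabs_le_between in Har'.
(* The sign at a + r comes from exp (- tau (a + r)) <= 1. *)
assert (Hx1 : exists x1, 0 <= x1 /\ x1 - a = r * exp (- tau * x1)).
{ destruct (IVT_gen (fun x => x - a - r * exp (- tau * x)) 0 (a + r) 0) as (x1 & Hx1 & E).
  - intros x. apply continuity_pt_filterlim.
    apply (ex_derive_continuous (fun x => x - a - r * exp (- tau * x))).
    auto_derive; trivial.
  - rewrite Rmult_0_r, exp_0.
    pose proof (exp_decay_le tau (a + r) 0 Htau).
    rewrite Rmult_0_r, exp_0 in H.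
    rewrite Rmin_left, Rmax_right; nra.
  - rewrite Rmin_left in Hx1 by lra. exists x1. lra. }
destruct Hx1 as (x1 & Hx1 & E1).
assert (Hm : 0 < r * exp (- tau * x1)) by (pose proof (exp_pos (- tau * x1)); nra).
assert (Hend : shifted_phase tau a r x1 = 0).
{ unfold shifted_phase, crossing_phase.
  replace (- (a - x1) / (r * exp (- tau * x1))) with 1
    by (rewrite <- E1; field; lra).
  rewrite acos_1. rewrite <- E1.
  replace ((x1 - a) ^ 2 - (a - x1) ^ 2) with 0 by ring.
  rewrite sqrt_0. ring. }
assert (Hd1 : Rabs (x1 - a) <= r * exp (- tau * x1)) by (rewrite Rabs_pos_eq; lra).
destruct (IVT_gen (shifted_phase tau a r) 0 x1 psi) as (x & Hx & E).
- intros x. apply continuity_pt_filterlim, continuous_shifted_phase, Hr.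
- rewrite Hend, shifted_phase_0.
  rewrite Rmin_right, Rmax_left; lra.
- rewrite Rmin_left, Rmax_right in Hx by lra.
  exists x. split; [lra |]. split; trivial.
  destruct (Req_dec x 0) as [-> | Hx0].
  { rewrite Rmult_0_r, exp_0, Rmult_1_r, Rminus_0_l, Rabs_Ropp. exact Har. }
  destruct (Req_dec x x1) as [-> | Hxx]; [exact Hd1 |].
  apply Rlt_le, (shifted_domain_interval tau a r x1); trivial. lra.
Qed.

Lemma right_root_abscissa_shift (tau a r psi x0 x : R) :
  right_root_abscissa tau (a - x0) (r * exp (- tau * x0)) psi x ->
  right_root_abscissa tau a r psi (x0 + x).
Proof.
assert (E : r * exp (- tau * (x0 + x)) = r * exp (- tau * x0) * exp (- tau * x)).
{ rewrite Rmult_assoc, <- exp_plus. do 2 f_equal. ring. }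
unfold right_root_abscissa, shifted_phase. rewrite E.
replace (x0 + x - a) with (x - (a - x0)) by ring.
replace (a - (x0 + x)) with (a - x0 - x) by ring.
trivial.
Qed.

Lemma crossing_phase_diag (tau a : R) : 0 < a -> crossing_phase tau a a = PI.
Proof.
intros Ha. unfold crossing_phase.
replace (a ^ 2 - a ^ 2) with 0 by ring.
replace (- a / a) with (- (1)) by (field; lra).
rewrite sqrt_0, acos_opp, acos_1. ring.
Qed.

(** For [r < a] the imaginary axis is not in the domain; the curve starts at
    the [x0] in [(0, a)] where the height vanishes on the left of [a]. After the
    shift by [x0] the modulus equals [a - x0], with crossing phase [PI]. *)
Lemma right_root_small_gain (tau a r psi : R) :
  0 < tau -> a <= 1 / tau -> 0 < r < a -> 0 <= psi <= PI ->
  exists x, 0 < x /\ right_root_abscissa tau a r psi x.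
Proof.
intros Htau Ha Hr Hpsi.
destruct (IVT_gen (fun x => r * exp (- tau * x) - (a - x)) 0 a 0) as (x0 & Hx0 & E).
- intros x. apply continuity_pt_filterlim.
  apply (ex_derive_continuous (fun x => r * exp (- tau * x) - (a - x))).
  auto_derive; trivial.
- rewrite Rmult_0_r, exp_0.
  pose proof (exp_pos (- tau * a)).
  rewrite Rmin_left, Rmax_right; nra.
- rewrite Rmin_left, Rmax_right in Hx0 by lra.
  assert (0 < r * exp (- tau * x0)) by (pose proof (exp_pos (- tau * x0)); nra).
  assert (x0 <> 0) by (intros ->; rewrite Rmult_0_r, exp_0 in E; lra).
  destruct (right_root_abscissa_exists tau (a - x0) (r * exp (- tau * x0)) psi)
    as (x & Hx & Hroot); trivial.
  + lra.
  + rewrite Rabs_pos_eq; lra.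
  + replace (r * exp (- tau * x0)) with (a - x0) by lra.
    rewrite crossing_phase_diag; lra.
  + exists (x0 + x). split; [lra |]. now apply right_root_abscissa_shift.
Qed.

(** * Arc tangent forms of the crossing phase *)

Lemma acos_ratio_atan (b r : R) :
  0 < b -> 0 < r -> acos (b / r) = atan (sqrt (r ^ 2 - b ^ 2) / b).
Proof.
intros Hb Hr. rewrite acos_atan by now apply Rdiv_lt_0_compat.
f_equal.
replace (1 - (b / r)²) with ((r ^ 2 - b ^ 2) / r ^ 2) by (unfold Rsqr; field; lra).
rewrite sqrt_div_alt, sqrt_pow2 by nra. field. lra.
Qed.

Lemma crossing_phase_neg (tau a r : R) :
  a < 0 -> 0 < r ->
  crossing_phase tau a r
  = tau * sqrt (r ^ 2 - a ^ 2) + atan (- (1 / a) * sqrt (r ^ 2 - a ^ 2)).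
Proof.
intros Ha Hr. unfold crossing_phase. rewrite acos_ratio_atan by lra.
do 2 f_equal. replace ((- a) ^ 2) with (a ^ 2) by ring. field. lra.
Qed.

Lemma crossing_phase_pos (tau a r : R) :
  0 < a -> 0 < r ->
  crossing_phase tau a r
  = tau * sqrt (r ^ 2 - a ^ 2) + atan (- (1 / a) * sqrt (r ^ 2 - a ^ 2)) + PI.
Proof.
intros Ha Hr. unfold crossing_phase.
replace (- a / r) with (- (a / r)) by (unfold Rdiv; ring).
rewrite acos_opp, acos_ratio_atan by lra.
replace (- (1 / a) * sqrt (r ^ 2 - a ^ 2)) with (- (sqrt (r ^ 2 - a ^ 2) / a))
  by (unfold Rdiv; ring).
rewrite atan_opp. ring.
Qed.

(** At [a = 1 / tau] the crossing phase is [PI + tau w - atan (tau w)], so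
    only the point [w = 0] remains. *)
Lemma crossing_phase_extremal (tau a r : R) :
  0 < tau -> a = 1 / tau -> a < r -> PI < crossing_phase tau a r.
Proof.
intros Htau Ha Hr.
assert (Ha0 : 0 < a) by (rewrite Ha; apply Rdiv_lt_0_compat; lra).
rewrite crossing_phase_pos by lra.
assert (Hw : 0 < sqrt (r ^ 2 - a ^ 2)) by (apply sqrt_lt_R0; nra).
set (w := sqrt (r ^ 2 - a ^ 2)) in *.
replace (- (1 / a) * w) with (- (tau * w)) by (rewrite Ha; field; lra).
rewrite atan_opp. pose proof (atan_lt_id (tau * w)). nra.
Qed.

(** Shifting by [a - 1 / tau] reduces to the extremal value [1 / tau], where
    a root with nonnegative real part exists for every phase. *)
Lemma right_root_large_a (tau a r psi : R) :
  0 < tau -> 1 / tau < a -> 0 < r -> 0 <= psi <= PI ->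
  exists x, 0 < x /\ right_root_abscissa tau a r psi x.
Proof.
intros Htau Ha Hr Hpsi.
set (x0 := a - 1 / tau). set (r' := r * exp (- tau * x0)).
assert (Hr' : 0 < r') by (unfold r'; pose proof (exp_pos (- tau * x0)); nra).
assert (Htau' : 0 < 1 / tau) by (apply Rdiv_lt_0_compat; lra).
assert (Hx : exists x, 0 <= x /\ right_root_abscissa tau (a - x0) r' psi x).
{ replace (a - x0) with (1 / tau) by (unfold x0; ring).
  destruct (Rlt_or_le r' (1 / tau)) as [Hlt | Hle].
  - destruct (right_root_small_gain tau (1 / tau) r' psi) as (x & Hx & Hroot); trivial; try lra.
    exists x. split; [lra | exact Hroot].
  - apply right_root_abscissa_exists; trivial; try lra.
    + rewrite Rabs_pos_eq; lra.
    + destruct Hle as [Hle | <-].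
      * pose proof (crossing_phase_extremal tau (1 / tau) r' Htau eq_refl Hle). lra.
      * rewrite crossing_phase_diag; lra. }
destruct Hx as (x & Hx & Hroot). exists (x0 + x). split.
- unfold x0. lra.
- now apply right_root_abscissa_shift.
Qed.

(** * Roots of the characteristic equation *)

Definition characteristic_root (tau a : R) (eta s : C) : Prop :=
  (s - RtoC a - eta * Cexp (- s * RtoC tau))%C = RtoC 0.

Lemma characteristic_root_coords (tau a : R) (eta s : C) :
  characteristic_root tau a eta s <->
  Re s - a = exp (- tau * Re s) * (Re eta * cos (tau * Im s) + Im eta * sin (tau * Im s)) /\
  Im s = exp (- tau * Re s) * (Im eta * cos (tau * Im s) - Re eta * sin (tau * Im s)).
Proof.
destruct s as [x y], eta as [e1 e2]. unfold characteristic_root, Cexp.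
cbn [Re Im fst snd].
replace (Re (- (x, y) * RtoC tau)%C) with (- tau * x) by (cbn; ring).
replace (Im (- (x, y) * RtoC tau)%C) with (- (tau * y)) by (cbn; ring).
rewrite cos_neg, sin_neg.
split.
- intros E. injection E. cbn. intros E2 E1. split; lra.
- intros [E1 E2]. unfold RtoC.
  apply injective_projections; cbn; lra.
Qed.

Lemma sign_decomposition (t : R) :
  exists sg, (sg = 1 \/ sg = -1) /\ t = sg * Rabs t.
Proof.
unfold Rabs. destruct (Rcase_abs t); [exists (-1) | exists 1]; split; auto; ring.
Qed.

Lemma Cmod_sq (z : C) : Cmod z ^ 2 = Re z ^ 2 + Im z ^ 2.
Proof.
unfold Cmod. rewrite pow2_sqrt; [reflexivity | destruct z; cbn; nra].
Qed.

Lemma unsigned_arg_cos (z : C) : 0 < Cmod z -> Re z = Cmod z * cos (unsigned_arg z).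
Proof.
intros Hz. unfold unsigned_arg. rewrite cos_acos.
- field. lra.
- apply Rdiv_abs_le_1; [exact Hz | apply re_le_Cmod].
Qed.

Lemma unsigned_arg_sin (z : C) : 0 < Cmod z -> Rabs (Im z) = Cmod z * sin (unsigned_arg z).
Proof.
intros Hz.
assert (Hs : 0 <= sin (unsigned_arg z)).
{ apply sin_ge_0; apply acos_bound. }
rewrite <- (Rabs_pos_eq (Cmod z * sin (unsigned_arg z))) by nra.
apply Rsqr_eq_abs_0. unfold Rsqr.
pose proof (Cmod_sq z). pose proof (unsigned_arg_cos z Hz) as Hc.
pose proof (sin2_cos2 (unsigned_arg z)) as H1. unfold Rsqr in H1.
set (c := cos _) in *. set (s := sin _) in *. rewrite Hc in H.
replace (Im z * Im z) with (Cmod z ^ 2 - (Cmod z * c) ^ 2) by lra.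
replace (Cmod z ^ 2) with (Cmod z ^ 2 * (s * s + c * c)) by (rewrite H1; ring). ring.
Qed.

Lemma Carg_unsigned (z : C) : Rabs (Carg z) = unsigned_arg z.
Proof.
unfold Carg, unsigned_arg. pose proof (acos_bound (Re z / Cmod z)).
destruct (Rle_dec 0 (Im z)); [| rewrite Rabs_Ropp]; apply Rabs_pos_eq; lra.
Qed.

(** Comparing cosines makes the sign of [Im s] disappear: replacing [s] and
    [eta] by their conjugates changes neither side. *)
Lemma root_on_vertical (tau a : R) (eta s : C) :
  0 < Cmod eta -> characteristic_root tau a eta s ->
  Rabs (Re s - a) <= Cmod eta * exp (- tau * Re s) /\
  cos (shifted_phase tau a (Cmod eta) (Re s)) = Re eta / Cmod eta.
Proof.
intros Hr Hroot. apply characteristic_root_coords in Hroot.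
set (x := Re s) in *. set (y := Im s) in *.
set (c := cos (tau * y)) in *. set (d := sin (tau * y)) in *.
destruct Hroot as [E1 E2].
pose proof (exp_pos (- tau * x)) as He. set (e := exp (- tau * x)) in *.
pose proof (Cmod_sq eta) as Hmod. pose proof (sin2_cos2 (tau * y)) as Hcd.
fold c d in Hcd. unfold Rsqr in Hcd.
set (r := Cmod eta) in *. set (e1 := Re eta) in *. set (e2 := Im eta) in *.
assert (Hm : 0 < r * e) by nra.
assert (Hsum : (x - a) ^ 2 + y ^ 2 = (r * e) ^ 2).
{ transitivity (e ^ 2 * (e1 ^ 2 + e2 ^ 2) * (d * d + c * c)).
  - rewrite E1, E2 at 1. ring.
  - rewrite Hcd, <- Hmod. ring. }
assert (Hp : Rabs (x - a) <= r * e).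
{ apply Rabs_le_between. split; nra. }
split; [exact Hp |].
unfold shifted_phase, crossing_phase. fold e.
replace ((r * e) ^ 2 - (a - x) ^ 2) with (y ^ 2) by lra.
replace (- (a - x)) with (x - a) by ring.
pose proof (Rdiv_abs_le_1 _ _ Hm Hp) as Ht.
rewrite cos_plus, cos_acos, sin_acos by exact Ht.
replace (1 - ((x - a) / (r * e))²) with (y ^ 2 / (r * e) ^ 2)
  by (replace (y ^ 2) with ((r * e) ^ 2 - (x - a) ^ 2) by lra; unfold Rsqr; field; lra).
rewrite sqrt_div_alt, (sqrt_pow2 (r * e)) by nra.
replace (y ^ 2) with (Rsqr y) by (unfold Rsqr; ring). rewrite sqrt_Rsqr_abs.
assert (Hcos : cos (tau * Rabs y) = c /\ sin (tau * Rabs y) * Rabs y = d * y).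
{ unfold c, d. unfold Rabs. destruct (Rcase_abs y); [| split; ring].
  replace (tau * - y) with (- (tau * y)) by ring.
  rewrite cos_neg, sin_neg. split; ring. }
destruct Hcos as [Hc Hd]. rewrite Hc.
replace (sin (tau * Rabs y) * (Rabs y / (r * e))) with (d * y / (r * e))
  by (rewrite <- Hd; unfold Rdiv; ring).
rewrite E1, E2 at 1.
replace (e1 / r) with (e1 * (d * d + c * c) / r) by (rewrite Hcd; unfold Rdiv; ring).
field. lra.
Qed.

Lemma root_of_abscissa (tau a : R) (eta : C) (x : R) :
  0 < Cmod eta -> right_root_abscissa tau a (Cmod eta) (unsigned_arg eta) x ->
  exists y, characteristic_root tau a eta (x, y).
Proof.
intros Hr [Hp Hph].
pose proof (exp_pos (- tau * x)) as He.
pose proof (unsigned_arg_cos eta Hr) as Hcos.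
pose proof (unsigned_arg_sin eta Hr) as Hsin.
rewrite <- Hph in Hcos, Hsin. clear Hph.
unfold shifted_phase, crossing_phase in Hcos, Hsin.
set (r := Cmod eta) in *. set (e := exp (- tau * x)) in *.
assert (Hm : 0 < r * e) by nra.
replace ((r * e) ^ 2 - (a - x) ^ 2) with ((r * e) ^ 2 - (x - a) ^ 2) in Hcos, Hsin by ring.
replace (- (a - x)) with (x - a) in Hcos, Hsin by ring.
pose proof (Rdiv_abs_le_1 _ _ Hm Hp) as Ht.
rewrite cos_plus, cos_acos, sin_acos in Hcos by exact Ht.
rewrite sin_plus, cos_acos, sin_acos in Hsin by exact Ht.
replace (1 - ((x - a) / (r * e))²) with (((r * e) ^ 2 - (x - a) ^ 2) / (r * e) ^ 2) in Hcos, Hsin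
  by (unfold Rsqr; field; lra).
rewrite sqrt_div_alt, (sqrt_pow2 (r * e)) in Hcos, Hsin by nra.
set (q := sqrt ((r * e) ^ 2 - (x - a) ^ 2)) in *.
pose proof (sin2_cos2 (tau * q)) as Hcd. unfold Rsqr in Hcd.
set (c := cos (tau * q)) in *. set (d := sin (tau * q)) in *.
destruct (sign_decomposition (Im eta)) as (sg & Hsg & Him). rewrite Hsin in Him.
(* The crossing is at height q up to sign; it lies on the side of Im eta. *)
exists (sg * q). apply characteristic_root_coords. cbn [Re Im fst snd].
fold e. rewrite Hcos, Him.
assert (Hcs : cos (tau * (sg * q)) = c /\ sin (tau * (sg * q)) = sg * d).
{ destruct Hsg as [-> | ->].
  - rewrite !Rmult_1_l. now split.
  - replace (tau * (-1 * q)) with (- (tau * q)) by ring.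
    rewrite cos_neg, sin_neg. split; [reflexivity | fold d; ring]. }
destruct Hcs as [-> ->].
assert (Hsg2 : sg * sg = 1) by (destruct Hsg as [-> | ->]; ring).
split.
- transitivity ((x - a) * (d * d + c * c)); [rewrite Hcd; ring |].
  transitivity ((x - a) * (c * c) + (x - a) * (d * d) * (sg * sg) + c * d * q * (sg * sg - 1));
    [rewrite Hsg2; ring | field; lra].
- transitivity (sg * q * (d * d + c * c)); [rewrite Hcd; ring | field; lra].
Qed.

(** The criterion for stability by the crossing phase. In the small disc
    ([a < 0], [|eta| < |a|]) the modulus excludes roots; elsewhere the phase is
    compared with its value on the imaginary axis. *)
Lemma no_right_root_iff (tau a : R) (eta : C) :
  0 < tau ->
  (forall s, characteristic_root tau a eta s -> ~ 0 < Re s) <->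
  a <= 1 / tau /\
  ((a < 0 /\ Cmod eta < Rabs a) \/ (a = 0 /\ eta = RtoC 0) \/
   (0 < Cmod eta /\ Rabs a <= Cmod eta /\
    crossing_phase tau a (Cmod eta) <= unsigned_arg eta)).
Proof.
intros Htau.
pose proof (inv_tau_pos tau Htau) as Hit.
assert (Hpsi : 0 <= unsigned_arg eta <= PI) by apply acos_bound.
split.
- intros Hno.
  assert (Hno' : 0 < Cmod eta ->
    ~ exists x, 0 < x /\ right_root_abscissa tau a (Cmod eta) (unsigned_arg eta) x).
  { intros Hr (x & Hx & Hroot).
    destruct (root_of_abscissa tau a eta x Hr Hroot) as (y & Hy).
    now apply (Hno (x, y) Hy). }
  destruct (Req_dec (Cmod eta) 0) as [H0 | H0].
  { apply Cmod_eq_0 in H0. subst eta.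
    assert (Ha : a <= 0).
    { apply Rnot_lt_le. apply (Hno (RtoC a)).
      unfold characteristic_root. ring. }
    split; [lra |].
    destruct Ha as [Ha | Ha]; [left | right; left; now split].
    split; [exact Ha |]. rewrite Cmod_0. apply Rabs_pos_lt. lra. }
  assert (Hr : 0 < Cmod eta) by (pose proof (Cmod_ge_0 eta); lra).
  specialize (Hno' Hr).
  assert (Ha : a <= 1 / tau).
  { apply Rnot_lt_le. intros Ha. apply Hno'. now apply right_root_large_a. }
  split; [exact Ha |].
  destruct (Rlt_or_le (Cmod eta) (Rabs a)) as [Hlt | Hle].
  + destruct (Rlt_or_le a 0) as [Hneg | Hpos]; [now left |].
    exfalso. apply Hno'. rewrite Rabs_pos_eq in Hlt by lra.
    apply right_root_small_gain; trivial. lra.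
  + right; right. split; [exact Hr | split; [exact Hle |]].
    apply Rnot_lt_le. intros Hlt. apply Hno'.
    destruct (right_root_abscissa_exists tau a (Cmod eta) (unsigned_arg eta))
      as (x & [Hx | <-] & Hroot); trivial; try lra.
    * now exists x.
    (* The abscissa 0 is excluded by the strict inequality of phases. *)
    * destruct Hroot as [_ Hroot]. rewrite shifted_phase_0 in Hroot. lra.
- intros [Ha Hcase] s Hroot Hs.
  assert (Hexp : exp (- tau * Re s) < 1).
  { rewrite <- exp_0. apply exp_increasing. nra. }
  destruct (Req_dec (Cmod eta) 0) as [H0 | H0].
  { apply Cmod_eq_0 in H0. subst eta.
    apply characteristic_root_coords in Hroot. cbn [Re Im fst snd RtoC] in Hroot.
    destruct Hroot as [E _].
    destruct Hcase as [[Hc _] | [[Hc _] | [Hc _]]]; [nra | nra |].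
    rewrite Cmod_0 in Hc. lra. }
  assert (Hr : 0 < Cmod eta) by (pose proof (Cmod_ge_0 eta); lra).
  destruct (root_on_vertical tau a eta s Hr Hroot) as [Hd Hcos].
  destruct Hcase as [[Hc Hlt] | [[_ Hc] | [_ [Har Hle]]]].
  + apply Rabs_le_between in Hd. rewrite Rabs_left in Hlt by lra. nra.
  + apply H0. rewrite Hc. apply Cmod_0.
  + pose proof (shifted_phase_lt tau a (Cmod eta) (Re s) Htau Ha Hr Har Hs Hd) as Hlt.
    (* Both angles lie in [0, PI], so equal cosines give equal angles. *)
    assert (unsigned_arg eta = shifted_phase tau a (Cmod eta) (Re s)); [| lra].
    unfold unsigned_arg. rewrite <- Hcos. apply acos_cos.
    split; [| lra]. unfold shifted_phase, crossing_phase.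
    apply Rplus_le_le_0_compat; [| apply acos_bound].
    apply Rmult_le_pos; [lra | apply sqrt_pos].
Qed.

Lemma crossing_phase_zero (tau r : R) :
  0 < r -> crossing_phase tau 0 r = tau * r + PI / 2.
Proof.
intros Hr. unfold crossing_phase.
replace (r ^ 2 - 0 ^ 2) with (r ^ 2) by ring. rewrite sqrt_pow2 by lra.
replace (- 0 / r) with 0 by (field; lra). now rewrite acos_0.
Qed.

Lemma crossing_phase_increasing (tau a r r' : R) :
  0 < tau -> a <= 0 -> Rabs a <= r < r' -> 0 < r ->
  crossing_phase tau a r < crossing_phase tau a r'.
Proof.
intros Htau [Ha | ->] Hr Hr0.
- rewrite !crossing_phase_neg by lra. rewrite Rabs_left in Hr by lra.
  assert (Hs : sqrt (r ^ 2 - a ^ 2) < sqrt (r' ^ 2 - a ^ 2)) by (apply sqrt_lt_1; nra).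
  assert (0 < - (1 / a)).
  { replace (- (1 / a)) with (1 / (- a)) by (field; lra). apply Rdiv_lt_0_compat; lra. }
  apply Rplus_lt_compat; [| apply atan_increasing]; nra.
- rewrite !crossing_phase_zero by lra. nra.
Qed.

(** * Limits of points of Lambda *)

(** The strict inequalities between phases survive as weak ones in the closure.
    Inside the disc [|z| < |a|] for [a < 0] the inequality holds by the default
    values: the square root is 0 there, and so is the crossing phase, except at
    the origin, where division by 0 makes both sides [acos 0]. *)
Lemma Lambda_separation (tau a : R) (z : C) :
  0 < tau -> Lambda tau a z ->
  crossing_phase tau a (Cmod z) <= unsigned_arg z /\ (0 < a -> a <= Cmod z).
Proof.
intros Htau HL. pose proof (inv_tau_pos tau Htau) as Hit.
assert (Hre := re_le_Cmod z). apply Rabs_le_between in Hre.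
destruct HL as [[Ha HL] | [[-> HL] | [[Ha HL] | [Ha ->]]]].
- split; [| lra]. destruct HL as [[Hge (ep & _ & _ & _ & _ & HL)] | Hlt].
  + rewrite Rabs_left in Hge by lra.
    rewrite crossing_phase_neg by lra. rewrite <- Carg_unsigned. apply Rlt_le, HL.
  + rewrite Rabs_left in Hlt by lra. pose proof (Cmod_ge_0 z) as [H0 | H0].
    * rewrite crossing_phase_neg by lra. rewrite sqrt_neg_0 by nra.
      rewrite !Rmult_0_r, atan_0, Rplus_0_l. apply acos_bound.
    * unfold crossing_phase, unsigned_arg. rewrite <- H0.
      rewrite sqrt_neg_0 by nra. unfold Rdiv. rewrite Rinv_0, !Rmult_0_r. lra.
- split; [| lra]. destruct HL as (Hz & _ & _ & HL).
  rewrite crossing_phase_zero by now apply Cmod_gt_0.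
  rewrite <- Carg_unsigned. lra.
- destruct HL as (ep & _ & _ & Hneg & _ & HL).
  split; [| lra].
  rewrite crossing_phase_pos by lra. rewrite <- Carg_unsigned. apply Rlt_le, HL.
- assert (Hm : Cmod (RtoC (- a)) = a) by (rewrite Cmod_R, Rabs_Ropp; apply Rabs_pos_eq; lra).
  split; [| lra]. unfold unsigned_arg. rewrite Hm, crossing_phase_diag by lra.
  cbn [Re RtoC fst]. replace (- a / a) with (- (1)) by (field; lra).
  rewrite acos_opp, acos_1. lra.
Qed.

Lemma Cmod_continuous (z : C) : continuous (Cmod : C_UniformSpace -> R) z.
Proof.
apply (continuous_ext (fun z : C => sqrt (fst z * fst z + snd z * snd z))).
- intros u. unfold Cmod. f_equal. ring.
- apply (continuous_comp (fun z : C => fst z * fst z + snd z * snd z) sqrt);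
    [| apply continuous_sqrt].
  apply (continuous_plus (fun z : C => fst z * fst z) (fun z : C => snd z * snd z)).
  + apply (continuous_mult (fst : C -> R) (fst : C -> R)); apply continuous_fst.
  + apply (continuous_mult (snd : C -> R) (snd : C -> R)); apply continuous_snd.
Qed.

Lemma Cclosure_nonneg (A : C -> Prop) (g : C -> R) (z : C) :
  continuous (g : C_UniformSpace -> R) z -> (forall w, A w -> 0 <= g w) ->
  Cclosure A z -> 0 <= g z.
Proof.
intros Hg HA Hz. apply Rnot_lt_le. intros Hneg.
assert (Hopp : 0 < - g z) by lra.
destruct (proj1 (filterlim_locally _ _) Hg (mkposreal _ Hopp)) as [eps Heps].
destruct (Hz eps (cond_pos eps)) as (w & Hw & Hd).
assert (Hb : ball (g z) (- g z) (g w)).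
{ apply Heps. pose proof (Rmax_Cmod (w - z)%C) as Hmax.
  split; apply Rle_lt_trans with (2 := Hd); eapply Rle_trans; try exact Hmax;
    [apply (Rmax_l (Rabs (fst (w - z)%C))) | apply (Rmax_r (Rabs (fst (w - z)%C)))]. }
apply Rabs_def2 in Hb. unfold minus, plus, opp in Hb; cbn in Hb.
specialize (HA w Hw). lra.
Qed.

(** Approximation by [Lambda] will be done along explicit paths. *)
Lemma Cclosure_of_path (A : C -> Prop) (p q : R -> R) :
  continuous p 0 -> continuous q 0 -> (forall d, 0 < d < 1 -> A (p d, q d)) ->
  Cclosure A (p 0, q 0).
Proof.
intros Hp Hq HA eps Heps.
assert (Heps2 : 0 < eps / 2) by lra.
destruct (proj1 (filterlim_locally _ _) Hp (mkposreal _ Heps2)) as [d1 H1].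
destruct (proj1 (filterlim_locally _ _) Hq (mkposreal _ Heps2)) as [d2 H2].
pose proof (cond_pos d1). pose proof (cond_pos d2).
set (m := Rmin 1 (Rmin d1 d2)).
assert (Hm : 0 < m) by (repeat apply Rmin_pos; lra).
assert (m <= 1) by apply Rmin_l.
assert (m <= d1) by (eapply Rle_trans; [apply Rmin_r | apply Rmin_l]).
assert (m <= d2) by (eapply Rle_trans; [apply Rmin_r | apply Rmin_r]).
assert (Hball : forall d : posreal, m <= d -> ball 0 d (m / 2)).
{ intros d Hd. apply Rabs_def1; unfold minus, plus, opp; cbn; lra. }
exists (p (m / 2), q (m / 2)). split; [apply HA; lra |].
specialize (H1 _ (Hball d1 ltac:(assumption))).
specialize (H2 _ (Hball d2 ltac:(assumption))).
change (Rabs (p (m / 2) - p 0) < eps / 2) in H1.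
change (Rabs (q (m / 2) - q 0) < eps / 2) in H2.
apply Rabs_def2 in H1. apply Rabs_def2 in H2.
unfold Cmod. cbn [fst snd Cminus Cplus Copp].
assert (Hsq : forall u, u < eps / 2 /\ - (eps / 2) < u -> u ^ 2 < (eps / 2) ^ 2) by (intros; nra).
apply Hsq in H1. apply Hsq in H2.
pose proof (pow2_ge_0 (p (m / 2) - p 0)). pose proof (pow2_ge_0 (q (m / 2) - q 0)).
assert (0 <= eps ^ 2) by apply pow2_ge_0.
rewrite <- (sqrt_pow2 eps) by lra. apply sqrt_lt_1; lra.
Qed.

Lemma closure_Lambda_bounds (tau a : R) (eta : C) :
  0 < tau -> eta <> RtoC 0 -> Cclosure (Lambda tau a) eta ->
  crossing_phase tau a (Cmod eta) <= unsigned_arg eta.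
Proof.
intros Htau Heta Hcl.
assert (Hr : Cmod eta <> 0) by now intros H; apply Heta, Cmod_eq_0.
enough (0 <= unsigned_arg eta - crossing_phase tau a (Cmod eta)) by lra.
apply (Cclosure_nonneg (Lambda tau a) (fun z => unsigned_arg z - crossing_phase tau a (Cmod z)));
  [| | exact Hcl].
- apply (continuous_minus (fun z : C_UniformSpace => unsigned_arg z)
    (fun z : C_UniformSpace => crossing_phase tau a (Cmod z))).
  + apply (continuous_comp (fun z : C_UniformSpace => Re z / Cmod z) acos);
      [| apply continuous_acos].
    apply (continuous_mult (fun z : C_UniformSpace => Re z) (fun z : C_UniformSpace => / Cmod z)).
    * apply (continuous_fst (U := R_UniformSpace) (V := R_UniformSpace)).
    * apply (continuous_comp (Cmod : C_UniformSpace -> R) Rinv);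
        [apply Cmod_continuous | now apply continuous_Rinv].
  + apply (continuous_crossing_phase C_UniformSpace tau (fun _ => a) Cmod); trivial.
    * apply continuous_const.
    * apply Cmod_continuous.
- intros w Hw. destruct (Lambda_separation tau a w Htau Hw). lra.
Qed.

Lemma closure_Lambda_modulus (tau a : R) (eta : C) :
  0 < tau -> 0 < a -> Cclosure (Lambda tau a) eta -> a <= Cmod eta.
Proof.
intros Htau Ha Hcl. enough (0 <= Cmod eta - a) by lra.
apply (Cclosure_nonneg (Lambda tau a) (fun z => Cmod z - a)); [| | exact Hcl].
- apply (continuous_minus (Cmod : C_UniformSpace -> R) (fun _ => a)).
  + apply Cmod_continuous.
  + apply continuous_const.
- intros w Hw. destruct (Lambda_separation tau a w Htau Hw). lra.
Qed.

(** * Membership in Lambda and approximation by it *)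

(** The half plane condition in [Lambda] follows from the phase condition,
    since [acos (- a / r)], the argument at which [Re z = - a], is at most the
    crossing phase. *)
Lemma re_lt_of_phase_lt (tau a : R) (z : C) :
  0 < tau -> 0 < Cmod z -> Rabs a <= Cmod z ->
  crossing_phase tau a (Cmod z) < unsigned_arg z -> Re z + a < 0.
Proof.
intros Htau Hr Ha Hlt.
rewrite <- Rabs_Ropp in Ha. pose proof (Rdiv_abs_le_1 _ _ Hr Ha) as Ht.
assert (Hc : cos (unsigned_arg z) < cos (acos (- a / Cmod z))).
{ pose proof (acos_bound (- a / Cmod z)). pose proof (acos_bound (Re z / Cmod z)).
  apply cos_decreasing_1; unfold unsigned_arg in *; try lra.
  unfold crossing_phase in Hlt.
  pose proof (sqrt_pos (Cmod z ^ 2 - a ^ 2)). nra. }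
rewrite cos_acos in Hc by exact Ht.
rewrite (unsigned_arg_cos z Hr).
apply (Rmult_lt_compat_l (Cmod z)) in Hc; [| exact Hr].
replace (Cmod z * (- a / Cmod z)) with (- a) in Hc by (field; lra). lra.
Qed.

Lemma Cmod_hypot (w a : R) : Cmod (RtoC (sqrt (w ^ 2 + a ^ 2))) ^ 2 - a ^ 2 = w ^ 2.
Proof.
rewrite Cmod_R, Rabs_pos_eq by apply sqrt_pos. rewrite pow2_sqrt by nra. ring.
Qed.

(** The modulus of [eta_pi] comes from the intermediate value theorem, and the
    bound by it is implied: the crossing phase is increasing and the argument
    is at most [PI]. *)
Lemma Lambda_neg_intro (tau a : R) (z : C) :
  0 < tau -> a < 0 -> Rabs a <= Cmod z ->
  crossing_phase tau a (Cmod z) < unsigned_arg z -> Lambda tau a z.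
Proof.
intros Htau Ha Hge Hlt.
assert (Hr : 0 < Cmod z) by (pose proof (Rabs_pos_lt a); lra).
left. split; [exact Ha |]. left. split; [lra |].
assert (Hb : 0 < - (1 / a)).
{ replace (- (1 / a)) with (1 / (- a)) by (field; lra). apply Rdiv_lt_0_compat; lra. }
set (b := - (1 / a)) in *.
pose proof PI_RGT_0 as Hpi.
assert (Hpt : 0 < PI / tau) by (apply Rdiv_lt_0_compat; lra).
(* At PI / tau the linear term alone is PI. *)
destruct (IVT_gen (fun w => tau * w + atan (b * w)) 0 (PI / tau) PI) as (w & Hw & E).
- intros w. apply continuity_pt_filterlim.
  apply (continuous_plus (fun w => tau * w) (fun w => atan (b * w))).
  + apply (ex_derive_continuous (fun w => tau * w)). auto_derive; trivial.
  + apply continuous_atan_comp.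
    apply (ex_derive_continuous (fun w => b * w)). auto_derive; trivial.
- rewrite !Rmult_0_r, atan_0, Rplus_0_l.
  replace (tau * (PI / tau)) with PI by (field; lra).
  assert (0 < atan (b * (PI / tau))).
  { rewrite <- atan_0. apply atan_increasing. nra. }
  rewrite Rmin_left, Rmax_right; lra.
- rewrite Rmin_left, Rmax_right in Hw by lra.
  assert (Hph : Lambda_phase tau a (RtoC (sqrt (w ^ 2 + a ^ 2))) = PI).
  { unfold Lambda_phase. rewrite Cmod_hypot, sqrt_pow2 by lra. exact E. }
  assert (Habs : Rabs a <= Cmod (RtoC (sqrt (w ^ 2 + a ^ 2)))).
  { rewrite Cmod_R, (Rabs_pos_eq (sqrt _)) by apply sqrt_pos.
    rewrite <- sqrt_Rsqr_abs. apply sqrt_le_1; unfold Rsqr; nra. }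
  set (ep := RtoC (sqrt (w ^ 2 + a ^ 2))) in *.
  exists ep. split; [exact Habs |]. split; [exact Hph |].
  split; [now apply (re_lt_of_phase_lt tau) |].
  split.
  + apply Rnot_le_lt. intros Hle.
    assert (Hpe : crossing_phase tau a (Cmod ep) = PI).
    { rewrite crossing_phase_neg by (pose proof (Rabs_pos_lt a); lra). exact Hph. }
    pose proof (acos_bound (Re z / Cmod z)) as Hb2. fold (unsigned_arg z) in Hb2.
    destruct Hle as [Hle | Hle].
    * pose proof (crossing_phase_increasing tau a (Cmod ep) (Cmod z) Htau) as Hinc.
      pose proof (Rabs_pos_lt a). lra.
    * rewrite Hle in Hpe. lra.
  + rewrite Carg_unsigned. rewrite crossing_phase_neg in Hlt by lra. exact Hlt.
Qed.

Lemma Lambda_zero_intro (tau : R) (z : C) :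
  0 < tau -> 0 < Cmod z ->
  crossing_phase tau 0 (Cmod z) < unsigned_arg z -> Lambda tau 0 z.
Proof.
intros Htau Hr Hlt. right; left. split; [reflexivity |].
assert (Hre : Re z + 0 < 0).
{ apply (re_lt_of_phase_lt tau); trivial. rewrite Rabs_R0. lra. }
rewrite crossing_phase_zero in Hlt by exact Hr.
pose proof (acos_bound (Re z / Cmod z)) as Hb. fold (unsigned_arg z) in Hb.
split; [now apply Cmod_gt_0 |]. split; [lra |]. split.
- apply (Rmult_lt_reg_l (2 * tau)); [lra |].
  replace (2 * tau * (PI / (2 * tau))) with PI by (field; lra). lra.
- rewrite Carg_unsigned. exact Hlt.
Qed.

(** For [a > 0] the distance of the crossing phase below [PI], as a function of
    the frequency [w = sqrt (r^2 - a^2)]; [eta_pi] corresponds to its positive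
    zero. *)
Definition phase_margin (tau a w : R) : R := atan (w / a) - tau * w.

Lemma phase_margin_0 (tau a : R) : phase_margin tau a 0 = 0.
Proof.
unfold phase_margin, Rdiv. rewrite Rmult_0_l, atan_0. ring.
Qed.

Lemma is_derive_phase_margin (tau a w : R) :
  0 < a -> is_derive (phase_margin tau a) w (a / (a ^ 2 + w ^ 2) - tau).
Proof.
intros Ha. unfold phase_margin.
apply (is_derive_minus (fun w => atan (w / a)) (fun w => tau * w)).
- replace (a / (a ^ 2 + w ^ 2)) with ((/ a) * (/ (1 + (w / a) ^ 2))) by (field; nra).
  apply (is_derive_comp atan (fun w => w / a)).
  + apply is_derive_Reals, derivable_pt_lim_atan.
  + auto_derive; trivial. field. lra.
- auto_derive; trivial. ring.
Qed.

Lemma continuous_phase_margin (tau a w : R) :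
  0 < a -> continuous (phase_margin tau a) w.
Proof.
intros Ha. apply (ex_derive_continuous (phase_margin tau a)).
eexists. now apply is_derive_phase_margin.
Qed.

(** The derivative [a / (a^2 + w^2) - tau] is decreasing and changes sign at
    [w = sqrt (a / tau - a^2)], which is positive exactly when [a < 1 / tau]. *)
Lemma phase_margin_unimodal (tau a : R) :
  0 < tau -> 0 < a < 1 / tau ->
  exists wc, 0 < wc /\
    (forall u v, 0 <= u < v -> v <= wc -> phase_margin tau a u < phase_margin tau a v) /\
    (forall u v, wc <= u < v -> phase_margin tau a v < phase_margin tau a u).
Proof.
intros Htau Ha.
assert (Hc : 0 < a / tau - a ^ 2).
{ replace (a / tau - a ^ 2) with (a * (1 / tau - a)) by (field; lra). nra. }
exists (sqrt (a / tau - a ^ 2)).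
pose proof (sqrt_lt_R0 _ Hc) as Hw. pose proof (sqrt_sqrt _ (Rlt_le _ _ Hc)) as Hw2.
set (wc := sqrt _) in *.
assert (Hwc : tau * (a ^ 2 + wc * wc) = a) by (rewrite Hw2; field; lra).
split; [exact Hw |]. split.
- intros u v Huv Hv.
  enough (- phase_margin tau a v < - phase_margin tau a u) by lra.
  apply (decreasing_of_derive_neg (fun w => - phase_margin tau a w)); [lra | |].
  + intros t _. apply (continuous_opp (phase_margin tau a)), continuous_phase_margin. lra.
  + intros t Ht. exists (- (a / (a ^ 2 + t ^ 2) - tau)). split.
    * enough (tau < a / (a ^ 2 + t ^ 2)) by lra.
      assert (tau * (t * t) < tau * (wc * wc)) by (apply Rmult_lt_compat_l; nra).
      apply Rlt_div_r; nra.
    * apply (is_derive_opp (phase_margin tau a)), is_derive_phase_margin. lra.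
- intros u v Huv. apply decreasing_of_derive_neg; [lra | |].
  + intros t _. apply continuous_phase_margin. lra.
  + intros t Ht. exists (a / (a ^ 2 + t ^ 2) - tau). split.
    * enough (a / (a ^ 2 + t ^ 2) < tau) by lra.
      assert (tau * (wc * wc) < tau * (t * t)) by (apply Rmult_lt_compat_l; nra).
      apply Rlt_div_l; nra.
    * apply is_derive_phase_margin. lra.
Qed.

Lemma crossing_phase_margin (tau a r : R) :
  0 < a -> 0 < r ->
  crossing_phase tau a r = PI - phase_margin tau a (sqrt (r ^ 2 - a ^ 2)).
Proof.
intros Ha Hr. rewrite crossing_phase_pos by lra. unfold phase_margin.
replace (- (1 / a) * sqrt (r ^ 2 - a ^ 2)) with (- (sqrt (r ^ 2 - a ^ 2) / a))
  by (unfold Rdiv; ring).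
rewrite atan_opp. ring.
Qed.

(** The zero of the margin beyond its maximum gives [eta_pi]; past it the
    margin is negative, so a point with the phase condition lies before it. *)
Lemma Lambda_pos_intro (tau a : R) (z : C) :
  0 < tau -> 0 < a < 1 / tau -> a <= Cmod z ->
  crossing_phase tau a (Cmod z) < unsigned_arg z -> Lambda tau a z.
Proof.
intros Htau Ha Hge Hlt.
right; right; left. split; [lra |].
destruct (phase_margin_unimodal tau a Htau Ha) as (wc & Hwc & Hinc & Hdec).
pose proof (phase_margin_0 tau a) as H0.
assert (Hpk : 0 < phase_margin tau a wc) by (rewrite <- H0; apply Hinc; lra).
pose proof PI_RGT_0 as Hpi.
assert (Hpt : 0 < PI / tau) by (apply Rdiv_lt_0_compat; lra).
(* Going PI / tau further costs PI, more than the arc tangent can give. *)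
assert (Hend : phase_margin tau a (wc + PI / tau) < 0).
{ unfold phase_margin. pose proof (atan_bound ((wc + PI / tau) / a)).
  replace (tau * (wc + PI / tau)) with (tau * wc + PI) by (field; lra). nra. }
destruct (IVT_gen (phase_margin tau a) wc (wc + PI / tau) 0) as (w & Hw & E).
- intros w. apply continuity_pt_filterlim, continuous_phase_margin. lra.
- rewrite Rmin_right, Rmax_left; lra.
- rewrite Rmin_left, Rmax_right in Hw by lra.
  set (ep := RtoC (sqrt (w ^ 2 + a ^ 2))).
  assert (Hmod : Cmod ep = sqrt (w ^ 2 + a ^ 2)).
  { unfold ep. rewrite Cmod_R. apply Rabs_pos_eq, sqrt_pos. }
  assert (Hea : a < Cmod ep).
  { rewrite Hmod. rewrite <- (sqrt_pow2 a) at 1 by lra. apply sqrt_lt_1; nra. }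
  exists ep. split; [exact Hea |]. split.
  { unfold Lambda_phase, ep. rewrite Cmod_hypot, sqrt_pow2 by lra.
    unfold phase_margin in E.
    replace (- (1 / a) * w) with (- (w / a)) by (unfold Rdiv; ring).
    rewrite atan_opp. lra. }
  split.
  { apply (re_lt_of_phase_lt tau); trivial; [lra |]. rewrite Rabs_pos_eq; lra. }
  pose proof (acos_bound (Re z / Cmod z)) as Hb. fold (unsigned_arg z) in Hb.
  split.
  + apply Rnot_le_lt. intros Hle.
    rewrite crossing_phase_margin in Hlt by lra.
    assert (Hww : w <= sqrt (Cmod z ^ 2 - a ^ 2)).
    { rewrite <- (sqrt_pow2 w) by lra. apply sqrt_le_1; [nra | nra |].
      replace (w ^ 2) with (Cmod ep ^ 2 - a ^ 2) by apply Cmod_hypot. nra. }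
    destruct Hww as [Hww | Hww]; [| rewrite <- Hww in Hlt; lra].
    specialize (Hdec w (sqrt (Cmod z ^ 2 - a ^ 2))). lra.
  + rewrite Carg_unsigned. rewrite crossing_phase_pos in Hlt by lra. exact Hlt.
Qed.

Lemma Cmod_scale (d : R) (z : C) :
  0 < d < 1 -> Cmod ((1 - d) * Re z, (1 - d) * Im z) = (1 - d) * Cmod z.
Proof.
intros Hd. rewrite <- (Rabs_pos_eq (1 - d)) at 3 by lra.
rewrite <- Cmod_R, <- Cmod_mult. f_equal.
destruct z as [x y]. apply injective_projections; cbn; ring.
Qed.

Lemma unsigned_arg_scale (d : R) (z : C) :
  0 < d < 1 -> unsigned_arg ((1 - d) * Re z, (1 - d) * Im z) = unsigned_arg z.
Proof.
intros Hd. unfold unsigned_arg. rewrite Cmod_scale by exact Hd. cbn [Re fst].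
destruct (Req_dec (Cmod z) 0) as [-> | Hz].
- rewrite Rmult_0_r. unfold Rdiv. now rewrite Rinv_0, !Rmult_0_r.
- f_equal. field. lra.
Qed.

(** Scaling towards the origin keeps the argument and strictly lowers the
    crossing phase, hence enters [Lambda] at once. *)
Lemma closure_Lambda_nonpos (tau a : R) (eta : C) :
  0 < tau -> a <= 0 -> 0 < Cmod eta -> Rabs a <= Cmod eta ->
  crossing_phase tau a (Cmod eta) <= unsigned_arg eta ->
  Cclosure (Lambda tau a) eta.
Proof.
intros Htau Ha Hr Hge Hle.
replace eta with ((1 - 0) * Re eta, (1 - 0) * Im eta)
  by (destruct eta; apply injective_projections; cbn; ring).
apply (Cclosure_of_path _ (fun d => (1 - d) * Re eta) (fun d => (1 - d) * Im eta)).
- apply (ex_derive_continuous (fun d => (1 - d) * Re eta)). auto_derive; trivial.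
- apply (ex_derive_continuous (fun d => (1 - d) * Im eta)). auto_derive; trivial.
- intros d Hd.
  pose proof (Cmod_scale d eta Hd) as Hm. pose proof (unsigned_arg_scale d eta Hd) as Harg.
  set (z := ((1 - d) * Re eta, (1 - d) * Im eta)) in *.
  destruct (Rlt_or_le (Cmod z) (Rabs a)) as [Hin | Hout].
  { left. split; [| now right].
    destruct Ha as [Ha | ->]; [exact Ha |].
    rewrite Rabs_R0 in Hin. pose proof (Cmod_ge_0 z). lra. }
  assert (Hlt : crossing_phase tau a (Cmod z) < unsigned_arg z).
  { rewrite Harg. apply Rlt_le_trans with (2 := Hle).
    apply crossing_phase_increasing; trivial; [split; [exact Hout |] |]; nra. }
  destruct Ha as [Ha | ->].
  + now apply Lambda_neg_intro.
  + apply Lambda_zero_intro; trivial. nra.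
Qed.

Lemma closure_Lambda_zero_origin (tau : R) :
  0 < tau -> Cclosure (Lambda tau 0) (RtoC 0).
Proof.
intros Htau. pose proof PI_RGT_0 as Hpi.
(* Half of the radius PI / (2 tau) of Lambda on the negative axis. *)
set (k := PI / (4 * tau)). assert (Hk : 0 < k) by (apply Rdiv_lt_0_compat; lra).
replace (RtoC 0) with ((- (k * 0)), 0) by (unfold RtoC; f_equal; ring).
apply (Cclosure_of_path _ (fun d => - (k * d)) (fun _ => 0)).
- apply (ex_derive_continuous (fun d => - (k * d))). auto_derive; trivial.
- apply continuous_const.
- intros d Hd. change (- (k * d), 0) with (RtoC (- (k * d))).
  assert (Hm : Cmod (RtoC (- (k * d))) = k * d).
  { rewrite Cmod_R, Rabs_Ropp. apply Rabs_pos_eq. nra. }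
  assert (0 < k * d) by nra.
  apply Lambda_zero_intro; trivial; [lra |].
  unfold unsigned_arg. rewrite Hm. cbn [Re RtoC fst].
  replace (- (k * d) / (k * d)) with (- (1)) by (field; nra).
  rewrite acos_opp, acos_1, crossing_phase_zero by lra.
  enough (tau * k = PI / 4) by nra. unfold k. field. lra.
Qed.

(** The crossing phase is not monotone in the modulus here, so the path is a
    segment in the coordinates (frequency, argument), aimed at the frequency
    [wc] of maximal margin and the argument [PI]. Moving towards [wc] increases
    the margin strictly, unless the frequency already is [wc]; there the
    margin is positive, so an argument below [PI] increases and an argument
    equal to [PI] already exceeds the crossing phase. *)
Lemma closure_Lambda_pos (tau a : R) (eta : C) :
  0 < tau -> 0 < a < 1 / tau -> a <= Cmod eta ->
  crossing_phase tau a (Cmod eta) <= unsigned_arg eta ->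
  Cclosure (Lambda tau a) eta.
Proof.
intros Htau Ha Hge Hle.
destruct (phase_margin_unimodal tau a Htau Ha) as (wc & Hwc & Hinc & Hdec).
rewrite crossing_phase_margin in Hle by lra.
pose proof (unsigned_arg_cos eta ltac:(lra)) as Hc.
pose proof (unsigned_arg_sin eta ltac:(lra)) as Hs.
pose proof (acos_bound (Re eta / Cmod eta)) as Hb. fold (unsigned_arg eta) in Hb.
set (psi := unsigned_arg eta) in *.
destruct (sign_decomposition (Im eta)) as (sg & Hsg & Him). rewrite Hs in Him.
set (w0 := sqrt (Cmod eta ^ 2 - a ^ 2)) in *.
assert (Hw0 : 0 <= w0) by apply sqrt_pos.
assert (Hw02 : w0 ^ 2 = Cmod eta ^ 2 - a ^ 2) by (apply pow2_sqrt; nra).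
set (w := fun d => w0 + d * (wc - w0)).
set (rad := fun d => sqrt (a ^ 2 + w d ^ 2)).
set (ang := fun d => psi + d * (PI - psi)).
replace eta with (rad 0 * cos (ang 0), sg * (rad 0 * sin (ang 0))).
2: { unfold rad, ang, w. rewrite !Rmult_0_l, !Rplus_0_r.
  replace (a ^ 2 + w0 ^ 2) with (Cmod eta ^ 2) by lra.
  rewrite sqrt_pow2, <- Hc, <- Him by lra. now destruct eta. }
assert (Crad : continuous rad 0).
{ apply continuous_sqrt_comp. apply (ex_derive_continuous (fun d => a ^ 2 + w d ^ 2)).
  unfold w. auto_derive; trivial. }
apply (Cclosure_of_path _ (fun d => rad d * cos (ang d)) (fun d => sg * (rad d * sin (ang d)))).
- apply (continuous_mult rad (fun d => cos (ang d))); [exact Crad |].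
  apply (ex_derive_continuous (fun d => cos (ang d))). unfold ang. auto_derive; trivial.
- apply (continuous_mult (fun _ => sg) (fun d => rad d * sin (ang d)));
    [apply continuous_const |].
  apply (continuous_mult rad (fun d => sin (ang d))); [exact Crad |].
  apply (ex_derive_continuous (fun d => sin (ang d))). unfold ang. auto_derive; trivial.
- intros d Hd.
  assert (Hwd : 0 < w d) by (unfold w; nra).
  assert (Hrad : a < rad d).
  { unfold rad. rewrite <- (sqrt_pow2 a) at 1 by lra. apply sqrt_lt_1; nra. }
  assert (Hrad2 : rad d ^ 2 = a ^ 2 + w d ^ 2) by (apply pow2_sqrt; nra).
  assert (Hang : 0 <= ang d <= PI) by (unfold ang; split; nra).
  assert (Hm : Cmod (rad d * cos (ang d), sg * (rad d * sin (ang d))) = rad d).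
  { unfold Cmod. cbn [fst snd]. rewrite <- (sqrt_pow2 (rad d)) at 3 by lra. f_equal.
    pose proof (sin2_cos2 (ang d)) as H1. unfold Rsqr in H1.
    transitivity (rad d ^ 2 * (sin (ang d) * sin (ang d) + cos (ang d) * cos (ang d)));
      [destruct Hsg as [-> | ->]; ring | rewrite H1; ring]. }
  assert (Ha' : unsigned_arg (rad d * cos (ang d), sg * (rad d * sin (ang d))) = ang d).
  { unfold unsigned_arg. rewrite Hm. cbn [Re fst].
    replace (rad d * cos (ang d) / rad d) with (cos (ang d)) by (field; lra).
    now apply acos_cos. }
  apply Lambda_pos_intro; trivial; rewrite ?Hm; [lra |].
  rewrite Ha', crossing_phase_margin by lra.
  replace (rad d ^ 2 - a ^ 2) with (w d ^ 2) by lra. rewrite sqrt_pow2 by lra.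
  destruct (Rtotal_order w0 wc) as [Hlt | [Heq | Hgt]].
  + assert (phase_margin tau a w0 < phase_margin tau a (w d)) by (apply Hinc; unfold w; nra).
    unfold ang. nra.
  + assert (Hpk : 0 < phase_margin tau a wc).
    { rewrite <- (phase_margin_0 tau a). apply Hinc; lra. }
    replace (w d) with wc by (unfold w; rewrite Heq; ring). rewrite Heq in Hle.
    unfold ang. nra.
  + assert (phase_margin tau a w0 < phase_margin tau a (w d)) by (apply Hdec; unfold w; nra).
    unfold ang. nra.
Qed.

Theorem theorem8 (tau a : R) (eta : C) (htau : 0 < tau) :
  (forall s : C,
     (s - RtoC a - eta * Cexp (- s * RtoC tau))%C = RtoC 0 -> ~ 0 < Re s)
  <->
  a <= 1 / tau /\ Cclosure (Lambda tau a) eta.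
Proof.
pose proof (inv_tau_pos tau htau) as Hit.
rewrite (no_right_root_iff tau a eta htau).
assert (Hself : forall A : C -> Prop, A eta -> Cclosure A eta).
{ intros A HA eps Heps. exists eta. split; [exact HA |].
  replace (eta - eta)%C with (RtoC 0) by ring. now rewrite Cmod_0. }
split; intros [Ha H]; (split; [exact Ha |]).
- destruct H as [[Hneg Hlt] | [[-> ->] | (Hr & Hge & Hle)]].
  + apply Hself. left. split; [exact Hneg | now right].
  + now apply closure_Lambda_zero_origin.
  + destruct (Rle_or_lt a 0) as [Hnp | Hpos]; [now apply closure_Lambda_nonpos |].
    rewrite Rabs_pos_eq in Hge by lra.
    destruct Ha as [Ha | Ha]; [now apply closure_Lambda_pos |].
    (* For a = 1 / tau the inequality of phases leaves only the point - a. *)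
    apply Hself. right; right; right. split; [exact Ha |].
    pose proof (acos_bound (Re eta / Cmod eta)) as Hb. fold (unsigned_arg eta) in Hb.
    destruct Hge as [Hgt | Heq].
    { pose proof (crossing_phase_extremal tau a (Cmod eta) htau Ha Hgt). lra. }
    rewrite <- Heq, crossing_phase_diag in Hle by lra.
    assert (Hpsi : unsigned_arg eta = PI) by lra.
    pose proof (unsigned_arg_cos eta Hr) as Hc. pose proof (unsigned_arg_sin eta Hr) as Hs.
    rewrite Hpsi, cos_PI, <- Heq in Hc. rewrite Hpsi, sin_PI, Rmult_0_r in Hs.
    apply injective_projections; cbn [RtoC fst snd].
    * change (fst eta) with (Re eta). lra.
    * change (snd eta) with (Im eta). destruct (Req_dec (Im eta) 0) as [E | E]; [exact E |].
      now apply Rabs_no_R0 in E.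
- destruct (Req_dec (Cmod eta) 0) as [H0 | H0].
  { apply Cmod_eq_0 in H0. subst eta. rewrite Cmod_0.
    destruct (Rtotal_order a 0) as [Hneg | [-> | Hpos]].
    - left. split; [exact Hneg |]. apply Rabs_pos_lt. lra.
    - right; left. now split.
    - pose proof (closure_Lambda_modulus tau a _ htau Hpos H) as Hm.
      rewrite Cmod_0 in Hm. lra. }
  assert (Hr : 0 < Cmod eta) by (pose proof (Cmod_ge_0 eta); lra).
  assert (Hle : crossing_phase tau a (Cmod eta) <= unsigned_arg eta).
  { apply closure_Lambda_bounds; trivial. now apply Cmod_gt_0. }
  destruct (Rlt_or_le (Cmod eta) (Rabs a)) as [Hlt | Hge].
  + left. split; [| exact Hlt]. apply Rnot_le_lt. intros Hpos.
    destruct Hpos as [Hpos | <-].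
    * pose proof (closure_Lambda_modulus tau a _ htau Hpos H) as Hm.
      rewrite Rabs_pos_eq in Hlt; lra.
    * rewrite Rabs_R0 in Hlt. lra.
  + right; right. now repeat split.
Qed.
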